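(* Let $\mathcal K$ and $\varpi(\cdot)$ be as in the context, $U\in\mathbb S^n_{\succ0}$, and let $\boldsymbol f(\cdot)\in\mathcal L^2_\varpi(\mathcal K;\mathbb R^d)$ satisfy $\int_{\mathcal K}\varpi(\tau)\boldsymbol f(\tau)\boldsymbol f^\top(\tau)d\tau\succ0$. Then for all $\boldsymbol x(\cdot)\in\mathcal L^2_\varpi(\mathcal K;\mathbb R^n)$, $$\int_{\mathcal K}\varpi(\tau)\boldsymbol x^\top(\tau)U\boldsymbol x(\tau)d\tau\ \ge\ \int_{\mathcal K}\varpi(\tau)\boldsymbol x^\top(\tau)F^\top(\tau)d\tau\,(\mathsf F\otimes U)\int_{\mathcal K}\varpi(\tau)F(\tau)\boldsymbol x(\tau)d\tau,$$ where $F(\tau)=\boldsymbol f(\tau)\otimes I_n$ and $\mathsf F^{-1}=\int_{\mathcal K}\varpi(\tau)\boldsymbol f(\tau)\boldsymbol f^\top(\tau)d\tau$.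
   Context: $\mathcal K\subseteq\mathbb R\cup\{\pm\infty\}$ has nonzero Lebesgue measure; $\varpi:\mathcal K\to\mathbb R_{\ge0}$ is measurable with only finitely or countably infinitely many zeros. $\mathcal L^2_\varpi(\mathcal K;\mathbb R^d)$ is the set of measurable $\boldsymbol\phi:\mathcal K\to\mathbb R^d$ with $\int_{\mathcal K}\varpi(\tau)\boldsymbol\phi^\top(\tau)\boldsymbol\phi(\tau)d\tau<\infty$. $\mathbb S^n_{\succ0}$: real symmetric positive definite $n\times n$ matrices. $\otimes$: Kronecker product. *)

(* Defs.v *)
From HB Require Import structures.
From mathcomp Require Import all_boot all_order all_algebra.
From mathcomp Require Import all_classical all_reals all_analysis.
From mathcomp Require Import measurable_realfun.
From mathcomp Require mxtens.
Import Order.TTheory GRing.Theory Num.Theory.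
Import numFieldNormedType.Exports.

Set Implicit Arguments.
Unset Strict Implicit.
Unset Printing Implicit Defensive.

Local Open Scope classical_set_scope.
Local Open Scope ring_scope.

(* The extended line with its Lebesgue sigma-algebra: A is measurable iff its
   finite part is Lebesgue (i.e. Caratheodory) measurable. The library's
   canonical structure on \bar R is the strictly smaller Borel sigma-algebra,
   hence the alias. *)
Definition elebesgueType (R : realType) : Type := \bar R.

Section elebesgue.
Variable R : realType.
Local Notation LR := (caratheodory_type (@wlength R idfun)^*%mu).

HB.instance Definition _ := Pointed.copy (elebesgueType R) (\bar R).

Definition elebesgue_measurable : set (set (elebesgueType R)) :=
  [set A | measurable ((EFin @^-1` A) : set LR)].

Let elebesgue_measurable0 : elebesgue_measurable set0.
Proof. by rewrite /elebesgue_measurable/= preimage_set0. Qed.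

Let elebesgue_measurableC (A : set (elebesgueType R)) :
  elebesgue_measurable A -> elebesgue_measurable (~` A).
Proof. by rewrite /elebesgue_measurable/= preimage_setC; exact: measurableC. Qed.

Let elebesgue_measurable_bigcup (F : (set (elebesgueType R))^nat) :
  (forall k, elebesgue_measurable (F k)) ->
  elebesgue_measurable (\bigcup_k F k).
Proof.
by move=> mF; rewrite /elebesgue_measurable/= preimage_bigcup;
  exact: bigcupT_measurable.
Qed.

HB.instance Definition _ := @isMeasurable.Build default_measure_display
  (elebesgueType R) elebesgue_measurable elebesgue_measurable0
  elebesgue_measurableC elebesgue_measurable_bigcup.

Definition EFinL (x : LR) : elebesgueType R := EFin x.

Lemma measurable_EFinL : measurable_fun [set: LR] EFinL.
Proof. by move=> _ A mA; rewrite setTI. Qed.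

(* Lebesgue measure on the extended line; +oo and -oo are null. *)
Definition elebesgue : set (elebesgueType R) -> \bar R :=
  pushforward (@completed_lebesgue_measure R) EFinL.

Let elebesgue0 : elebesgue set0 = 0%E.
Proof. by rewrite /elebesgue /pushforward preimage_set0 measure0. Qed.

Let elebesgue_ge0 A : (0 <= elebesgue A)%E.
Proof. by rewrite /elebesgue /pushforward measure_ge0. Qed.

Let elebesgue_sigma_additive : semi_sigma_additive elebesgue.
Proof.
move=> F mF tF mUF; rewrite /elebesgue /pushforward preimage_bigcup.
apply: (@measure_semi_sigma_additive _ _ _ (@completed_lebesgue_measure R)
  (fun n => EFinL @^-1` F n)) => //.
apply/trivIsetP => i j _ _ ij; rewrite -preimage_setI.
by move/trivIsetP : tF => -> //; rewrite preimage_set0.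
Qed.

HB.instance Definition _ := isMeasure.Build _ _ _ elebesgue
  elebesgue0 elebesgue_ge0 elebesgue_sigma_additive.

(* On Borel sets this is the library's measure on \bar R. *)
Lemma elebesgue_borel (A : set (\bar R)) : measurable A ->
  measurable (A : set (elebesgueType R)) /\ elebesgue A = elebesgue_measure A.
Proof.
move=> mA.
have mfA : measurable (EFin @^-1` A : set (measurableTypeR R)).
  by rewrite -[X in measurable X]setTI; exact: EFin_measurable.
split; first exact: sub_caratheodory.
rewrite /elebesgue /pushforward /elebesgue_measure.
suff -> : fine @` (A `\` [set -oo; +oo]%E) = EFin @^-1` A by [].
apply/seteqP; split=> [_ [[r| |] [Ax nx] <-]|r Ar] //=.
- by case: nx; right.
- by case: nx; left.
- by exists r%:E => //; split=> // -[].
Qed.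

End elebesgue.

Section matrices.

Definition posdefmx (R : realType) (n : nat) (A : 'M[R]_n) : Prop :=
  A \is symmetricmx /\
  forall v : 'cV[R]_n, v != 0 -> 0 < (v^T *m A *m v) 0 0.

(* f (x) I_n for a column vector f; the cast is from 1 * n to n columns. *)
Definition kron_id (R : realType) (d n : nat) (f : 'cV[R]_d) :
    'M[R]_(d * n, n) :=
  castmx (erefl (d * n)%N, mul1n n) (mxtens.tensmx f (1%:M : 'M[R]_n)).

End matrices.

Section integrals.
Context (disp : measure_display) (T : measurableType disp) (R : realType).
Variable mu : {measure set T -> \bar R}.

(* Entrywise; as for the library's real-valued integral, an infinite entry is
   read as 0, which does not occur for products of square-integrable data. *)
Definition mxRintegral (D : set T) (m n : nat) (A : T -> 'M[R]_(m, n)) :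
    'M[R]_(m, n) :=
  \matrix_(i, j) \int[mu]_(t in D) A t i j.

(* Measurability of a vector-valued function is coordinatewise. *)
Definition wL2 (D : set T) (w : T -> R) (d : nat) (phi : T -> 'cV[R]_d) : Prop :=
  (forall i, measurable_fun D (fun t => phi t i 0)) /\
  (\int[mu]_(t in D) (w t * ((phi t)^T *m phi t) 0 0)%:E < +oo)%E.

End integrals.

(* Main.v *)
Require Import Defs.
From HB Require Import structures.
From mathcomp Require Import all_boot all_order all_algebra.
From mathcomp Require Import all_classical all_reals all_analysis.
From mathcomp Require Import measurable_realfun.
From mathcomp Require Import ring.
From mathcomp Require mxtens.
Import Order.TTheory GRing.Theory Num.Theory.
Import numFieldNormedType.Exports.

Set Implicit Arguments.
Unset Strict Implicit.
Unset Printing Implicit Defensive.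

Local Open Scope classical_set_scope.
Local Open Scope ring_scope.

(** The claim is the completion of a square in the space of square-integrable
functions.  Write [G] for the Gram matrix [\int w f f^T], so that [Fs = G^-1],
and [B] for the cross moment [\int w x f^T].  The best approximation of [x] by
a constant matrix times [f] is [B Fs f]; let [e = x - B Fs f] be the residual.
Expanding the product and using only linearity of the integral gives the Schur
complement identity [\int w e e^T = \int w x x^T - B Fs B^T]
([gram_residual]).  As [U] is positive definite, [w e^T U e] is nonnegative,
hence so is its integral, which is the trace of [U] times that matrix:

  [0 <= \int w x^T U x - \tr (U B Fs B^T)].

What remains is to recognise the subtracted trace as the right-hand quadratic
form of the theorem.  This is the vectorisation rule for Kronecker products:
[(f (x) I) x] stacks the columns of [x f^T], so [\int w F x] stacks the columns
of [B], and the quadratic form of [Fs (x) U] at a stacked matrix [B] is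
[\tr (U B Fs^T B^T)] ([kron_id_mul_vec], [vec_tensmx_quad]).

All manipulations of integrals are legitimate because products of coordinates
of weighted square-integrable functions are integrable, by
[2 |a b| <= a^2 + b^2] ([wL2_integrable_gram]). *)

(** * Vectorisation and Kronecker products *)

(** The columns of [B] on top of one another, in the index order of
[mxtens.tensmx]. *)
Definition mxcolvec (R : Type) (n d : nat) (B : 'M[R]_(n, d)) :
    'cV[R]_(d * n) :=
  \col_k B (mxtens.mxtens_unindex k).2 (mxtens.mxtens_unindex k).1.

Lemma kron_id_mul_vec (R : realType) (d n : nat) (f : 'cV[R]_d)
    (x : 'cV[R]_n) :
  kron_id n f *m x = mxcolvec (x *m f^T).
Proof.
apply/colP => k; rewrite !mxE big_ord1 mxE mulrC.
have kronE j : kron_id n f k j =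
    f (mxtens.mxtens_unindex k).1 0 * ((mxtens.mxtens_unindex k).2 == j)%:R.
  rewrite castmxE !mxE cast_ord_id.
  rewrite (ord1 (mxtens.mxtens_unindex (cast_ord _ j)).1).
  congr (_ * (_ == _)%:R).
  by apply: val_inj; rewrite /= modn_small.
rewrite (bigD1 (mxtens.mxtens_unindex k).2)//= kronE eqxx mulr1 big1 ?addr0//.
by move=> j /negPf jk; rewrite kronE eq_sym jk mulr0 mul0r.
Qed.

(** Both sides are the sum of [U k l * B l i * P j i * B k j]; only the order
of summation and the pairing of indices differ. *)
Lemma vec_tensmx_quad (R : comPzRingType) (d n : nat) (P : 'M[R]_d)
    (U : 'M[R]_n) (B : 'M[R]_(n, d)) :
  ((mxcolvec B)^T *m mxtens.tensmx P U *m mxcolvec B) 0 0 =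
  \tr (U *m (B *m P^T *m B^T)).
Proof.
have sum_unindex (h : 'I_d * 'I_n -> R) :
    \sum_(k < d * n) h (mxtens.mxtens_unindex k) = \sum_i \sum_j h (i, j).
  rewrite pair_big /= (reindex (@mxtens.mxtens_index d n))/=; last first.
    exists (@mxtens.mxtens_unindex d n) => k _;
      by rewrite (mxtens.mxtens_indexK, mxtens.mxtens_unindexK).
  by apply: eq_bigr => -[i j] _; rewrite mxtens.mxtens_indexK.
rewrite mxE; under eq_bigr => k _.
  rewrite !mxE; under eq_bigr => l _ do rewrite !mxE.
  rewrite (sum_unindex (fun p => B p.2 p.1 *
    (P p.1 (mxtens.mxtens_unindex k).1 * U p.2 (mxtens.mxtens_unindex k).2)))/=.
  over.
rewrite (sum_unindex (fun q => (\sum_i \sum_j B j i * (P i q.1 * U j q.2)) *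
  B q.2 q.1))/=.
transitivity (\sum_k \sum_l \sum_i \sum_j
    U k l * (B l i * P j i * B k j)); last first.
  apply: eq_bigr => k _; rewrite mxE; apply: eq_bigr => l _.
  rewrite mxE mulr_sumr exchange_big/=; apply: eq_bigr => j _.
  by rewrite !mxE mulr_suml mulr_sumr; apply: eq_bigr => i _; rewrite !mxE.
rewrite [RHS]exchange_big/= exchange_big/=; apply: eq_bigr => l _.
rewrite [RHS]exchange_big/=; apply: eq_bigr => i _.
rewrite mulr_suml [RHS]exchange_big/=; apply: eq_bigr => j _.
rewrite mulr_suml; apply: eq_bigr => k _.
by ring.
Qed.

(** * Linearity of entrywise integrals *)

Section mxRintegral_theory.
Context (disp : measure_display) (T : measurableType disp) (R : realType).
Variables (mu : {measure set T -> \bar R}) (D : set T).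
Hypothesis mD : measurable D.

Definition mxintegrable (m n : nat) (A : T -> 'M[R]_(m, n)) : Prop :=
  forall i j, mu.-integrable D (EFin \o (fun t => A t i j)).

Lemma Rintegral_sum (I : Type) (s : seq I) (h : I -> T -> R) :
  (forall i, mu.-integrable D (EFin \o h i)) ->
  \int[mu]_(t in D) (\sum_(i <- s) h i t) =
  \sum_(i <- s) \int[mu]_(t in D) h i t.
Proof.
move=> ih; rewrite /Rintegral; under eq_integral do rewrite -sumEFin.
rewrite integral_sum// sum_fine// => i _.
exact: integrable_fin_num (ih i).
Qed.

Lemma mxintegrableB (m n : nat) (A B : T -> 'M[R]_(m, n)) :
  mxintegrable A -> mxintegrable B -> mxintegrable (fun t => A t - B t).
Proof.
move=> iA iB i j.
rewrite (_ : _ \o _ = fun t => ((A t i j)%:E - (B t i j)%:E)%E).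
  exact: (integrableB mD (iA i j) (iB i j)).
by apply/funext => t; rewrite /= !mxE EFinB.
Qed.

Lemma mxintegrable_tr (m n : nat) (A : T -> 'M[R]_(m, n)) :
  mxintegrable A -> mxintegrable (fun t => (A t)^T).
Proof.
move=> iA i j.
rewrite (_ : _ \o _ = EFin \o (fun t => A t j i)); first exact: iA.
by apply/funext => t /=; rewrite mxE.
Qed.

Lemma mxintegrableMl (l m n : nat) (C : 'M[R]_(l, m)) (A : T -> 'M[R]_(m, n)) :
  mxintegrable A -> mxintegrable (fun t => C *m A t).
Proof.
move=> iA i j; rewrite (_ : _ \o _ =
    fun t => (\sum_k (C i k)%:E * (A t k j)%:E)%E).
  by apply: integrable_sum => // k _; exact: (integrableZl mD _ (iA k j)).
by apply/funext => t; rewrite /= mxE -sumEFin.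
Qed.

Lemma mxintegrableMr (l m n : nat) (C : 'M[R]_(n, l)) (A : T -> 'M[R]_(m, n)) :
  mxintegrable A -> mxintegrable (fun t => A t *m C).
Proof.
move=> /mxintegrable_tr /(mxintegrableMl C^T)/mxintegrable_tr iA.
rewrite (_ : (fun _ => _) = fun t => (C^T *m (A t)^T)^T)//.
by apply/funext => t; rewrite trmx_mul !trmxK.
Qed.

Lemma mxRintegral_tr (m n : nat) (A : T -> 'M[R]_(m, n)) :
  mxRintegral mu D (fun t => (A t)^T) = (mxRintegral mu D A)^T.
Proof.
by apply/matrixP => i j; rewrite !mxE; apply: eq_Rintegral => t _; rewrite mxE.
Qed.

Lemma mxRintegralB (m n : nat) (A B : T -> 'M[R]_(m, n)) :
  mxintegrable A -> mxintegrable B ->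
  mxRintegral mu D (fun t => A t - B t) =
  mxRintegral mu D A - mxRintegral mu D B.
Proof.
move=> iA iB; apply/matrixP => i j; rewrite !mxE -RintegralB//.
by apply: eq_Rintegral => t _; rewrite !mxE.
Qed.

Lemma mxRintegralMl (l m n : nat) (C : 'M[R]_(l, m)) (A : T -> 'M[R]_(m, n)) :
  mxintegrable A ->
  mxRintegral mu D (fun t => C *m A t) = C *m mxRintegral mu D A.
Proof.
move=> iA; apply/matrixP => i j; rewrite !mxE.
under eq_bigr do rewrite mxE -RintegralZl//.
rewrite -Rintegral_sum => [|k].
  by apply: eq_Rintegral => t _; rewrite mxE.
rewrite (_ : _ \o _ = fun t => ((C i k)%:E * (A t k j)%:E)%E)//.
exact: (integrableZl mD _ (iA k j)).
Qed.

Lemma mxRintegralMr (l m n : nat) (C : 'M[R]_(n, l)) (A : T -> 'M[R]_(m, n)) :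
  mxintegrable A ->
  mxRintegral mu D (fun t => A t *m C) = mxRintegral mu D A *m C.
Proof.
move=> iA; apply: trmx_inj; rewrite -mxRintegral_tr trmx_mul -mxRintegral_tr.
rewrite -mxRintegralMl; last exact: mxintegrable_tr.
by congr mxRintegral; apply/funext => t; rewrite trmx_mul.
Qed.

Lemma mxtrace_mxRintegral (n : nat) (A : T -> 'M[R]_n) : mxintegrable A ->
  \tr (mxRintegral mu D A) = \int[mu]_(t in D) \tr (A t).
Proof.
move=> iA; rewrite /mxtrace Rintegral_sum//.
by apply: eq_bigr => i _; rewrite mxE.
Qed.

(** * Weighted Gram matrices *)

Section gram.
Variable w : T -> R.
Hypotheses (mw : measurable_fun D w) (w_ge0 : forall t, D t -> 0 <= w t).

Definition wgram (m n : nat) (y : T -> 'cV[R]_m) (z : T -> 'cV[R]_n) :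
    'M[R]_(m, n) :=
  mxRintegral mu D (fun t => w t *: (y t *m (z t)^T)).

Lemma wL2_integrable_sqr (n : nat) (y : T -> 'cV[R]_n) (i : 'I_n) :
  wL2 mu D w y -> mu.-integrable D (EFin \o (fun t => w t * y t i 0 ^+ 2)).
Proof.
move=> [my iy]; have myy : measurable_fun D (fun t => ((y t)^T *m y t) 0 0).
  rewrite (_ : (fun _ => _) = fun t => \sum_k y t k 0 * y t k 0).
    by apply: measurable_sum => k; exact: measurable_funM.
  by apply/funext => t; rewrite mxE; apply: eq_bigr => k _; rewrite mxE.
have yyE t : ((y t)^T *m y t) 0 0 = \sum_k y t k 0 ^+ 2.
  by rewrite mxE; apply: eq_bigr => k _; rewrite mxE.
have yy_ge0 t : 0 <= ((y t)^T *m y t) 0 0.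
  by rewrite yyE sumr_ge0// => k _; exact: sqr_ge0.
apply: (@le_integrable _ _ _ _ _ mD _
  (EFin \o (fun t => w t * ((y t)^T *m y t) 0 0))).
- by apply/measurable_EFinP/measurable_funM => //; exact: measurable_funX.
- move=> t Dt /=; have w0 := w_ge0 Dt; have sq0 := sqr_ge0 (y t i 0).
  rewrite lee_fin !ger0_norm; [|exact: mulr_ge0..].
  rewrite ler_wpM2l ?w_ge0// yyE (bigD1 i)//= lerDl sumr_ge0// => k _.
  exact: sqr_ge0.
- apply/integrableP; split; first exact/measurable_EFinP/measurable_funM.
  rewrite (eq_integral (fun t => (w t * ((y t)^T *m y t) 0 0)%:E))// => t.
  by rewrite inE => Dt; rewrite /= ger0_norm// mulr_ge0// w_ge0.
Qed.

(** The dominating function is [w y_i^2 + w z_j^2], because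
[|y_i z_j| <= 2 |y_i z_j| <= y_i^2 + z_j^2]. *)
Lemma wL2_integrable_gram (m n : nat) (y : T -> 'cV[R]_m) (z : T -> 'cV[R]_n) :
  wL2 mu D w y -> wL2 mu D w z ->
  mxintegrable (fun t => w t *: (y t *m (z t)^T)).
Proof.
move=> yL2 zL2 i j.
apply: (@le_integrable _ _ _ _ _ mD _
  (EFin \o (fun t => w t * y t i 0 ^+ 2 + w t * z t j 0 ^+ 2))).
- apply/measurable_EFinP.
  rewrite (_ : (fun _ => _) = fun t => w t * (y t i 0 * z t j 0)).
    by apply: measurable_funM => //; apply: measurable_funM;
      [case: yL2 | case: zL2].
  by apply/funext => t; rewrite !mxE big_ord1 mxE.
- move=> t Dt; rewrite /= lee_fin !mxE big_ord1 mxE -mulrDr !normrM.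
  rewrite ler_wpM2l// [leRHS]ger0_norm ?addr_ge0 ?sqr_ge0//.
  rewrite -(real_normK (num_real (y t i 0))) -(real_normK (num_real (z t j 0))).
  have := sqr_ge0 (`|y t i 0| - `|z t j 0|).
  rewrite sqrrB addrAC subr_ge0; apply: le_trans.
  by rewrite mulr2n lerDl mulr_ge0.
- exact: (integrableD mD (wL2_integrable_sqr i yL2) (wL2_integrable_sqr j zL2)).
Qed.

(** The Schur complement: [wgram y z *m P] is the matrix of the least-squares
regression of [y] on [z].  In the expansion of [wgram e e] the part
[wgram e z] vanishes, that is, the residual is orthogonal to [z].  Being
the inverse of a Gram matrix, [P] is symmetric; the conclusion has [P^T] to
match [vec_tensmx_quad]. *)
Lemma gram_residual (m n : nat) (y : T -> 'cV[R]_m) (z : T -> 'cV[R]_n)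
    (P : 'M[R]_n) :
  wL2 mu D w y -> wL2 mu D w z ->
  P \in unitmx -> invmx P = wgram z z ->
  let e t := y t - wgram y z *m P *m z t in
  mxintegrable (fun t => w t *: (e t *m (e t)^T)) /\
  wgram e e = wgram y y - wgram y z *m P^T *m (wgram y z)^T.
Proof.
move=> yL2 zL2 Pu PG e; set B := wgram y z; pose C := B *m P.
have iyy := wL2_integrable_gram yL2 yL2.
have iyz := wL2_integrable_gram yL2 zL2.
have izy := wL2_integrable_gram zL2 yL2.
have izz := wL2_integrable_gram zL2 zL2.
have eE : (fun t => w t *: (e t *m (e t)^T)) = (fun t =>
    w t *: (y t *m (y t)^T) - w t *: (y t *m (z t)^T) *m C^T -
    C *m (w t *: (z t *m (y t)^T) - w t *: (z t *m (z t)^T) *m C^T)).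
  apply/funext => t; rewrite /e -/C linearB/= trmx_mul.
  rewrite mulmxBl !mulmxBr !scalerBr !mulmxA.
  by rewrite -?scalemxAl -?scalemxAr -?scalemxAl !mulmxA.
have i1 := mxintegrableB iyy (mxintegrableMr C^T iyz).
have i2 := mxintegrableB izy (mxintegrableMr C^T izz).
rewrite /wgram eE; split; first exact/mxintegrableB/mxintegrableMl.
rewrite mxRintegralB//; last exact: mxintegrableMl.
rewrite mxRintegralMl// !mxRintegralB ?mxRintegralMr//;
  try exact: mxintegrableMr.
rewrite -!/(wgram _ _) -/B -PG.
have -> : wgram z y = B^T.
  rewrite /B /wgram -mxRintegral_tr; congr mxRintegral; apply/funext => t.
  by rewrite linearZ/= trmx_mul trmxK.
have Psym : P^T = P.
  rewrite -[LHS]invmxK -trmx_inv PG /wgram -mxRintegral_tr -[RHS]invmxK PG.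
  congr (invmx (mxRintegral _ _ _)); apply/funext => t.
  by rewrite linearZ/= trmx_mul trmxK.
by rewrite /C trmx_mul Psym !mulmxA mulVmx// mul1mx subrr mulmx0 subr0.
Qed.

Lemma mxtrace_wgram (n : nat) (U : 'M[R]_n) (y : T -> 'cV[R]_n) :
  mxintegrable (fun t => w t *: (y t *m (y t)^T)) ->
  \tr (U *m wgram y y) = \int[mu]_(t in D) (w t * ((y t)^T *m U *m y t) 0 0).
Proof.
move=> iyy; rewrite -mxRintegralMl// mxtrace_mxRintegral; last first.
  exact: mxintegrableMl.
apply: eq_Rintegral => t _.
by rewrite -scalemxAr mxtraceZ mulmxA mxtrace_mulC mulmxA trace_mx11.
Qed.

(** Integrate [w e^T U e >= 0] for the regression residual [e]. *)
Lemma gram_trace_le (m n : nat) (U : 'M[R]_m) (P : 'M[R]_n)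
    (y : T -> 'cV[R]_m) (z : T -> 'cV[R]_n) :
  (forall v : 'cV[R]_m, 0 <= (v^T *m U *m v) 0 0) ->
  wL2 mu D w y -> wL2 mu D w z ->
  P \in unitmx -> invmx P = wgram z z ->
  \tr (U *m (wgram y z *m P^T *m (wgram y z)^T)) <=
  \int[mu]_(t in D) (w t * ((y t)^T *m U *m y t) 0 0).
Proof.
move=> U_ge0 yL2 zL2 Pu PG.
have [iee eeE] := gram_residual yL2 zL2 Pu PG.
rewrite -mxtrace_wgram; last exact: wL2_integrable_gram.
rewrite -subr_ge0 -raddfB -mulmxBr -eeE /= mxtrace_wgram//.
by apply: Rintegral_ge0 => t Dt; rewrite mulr_ge0 ?w_ge0.
Qed.

End gram.
End mxRintegral_theory.

Lemma posdefmx_ge0 (R : realType) (n : nat) (U : 'M[R]_n) (v : 'cV[R]_n) :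
  posdefmx U -> 0 <= (v^T *m U *m v) 0 0.
Proof.
move=> [_ U_gt0]; have [->|v0] := eqVneq v 0; last exact/ltW/U_gt0.
by rewrite mulmx0 mxE.
Qed.

(** * The inequality *)

Theorem theorem4p1 (R : realType) (K : set (elebesgueType R))
    (w : elebesgueType R -> R) (d n : nat) (U : 'M[R]_n)
    (f : elebesgueType R -> 'cV[R]_d) (Fs : 'M[R]_d)
    (mK : measurable K) (K_neq0 : elebesgue K <> 0%E)
    (mw : measurable_fun K w) (w_ge0 : forall t, K t -> 0 <= w t)
    (w_zeros : countable [set t | K t /\ w t = 0])
    (U_posdef : posdefmx U)
    (fL2 : wL2 (@elebesgue R) K w f)
    (f_posdef : posdefmx
       (mxRintegral (@elebesgue R) K (fun t => w t *: (f t *m (f t)^T))))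
    (Fs_unit : Fs \in unitmx)
    (Fs_inv : invmx Fs =
       mxRintegral (@elebesgue R) K (fun t => w t *: (f t *m (f t)^T))) :
  forall x : elebesgueType R -> 'cV[R]_n, wL2 (@elebesgue R) K w x ->
  let F t := kron_id n (f t) in
  (mxRintegral (@elebesgue R) K (fun t => w t *: ((x t)^T *m (F t)^T)) *m
     mxtens.tensmx Fs U *m
     mxRintegral (@elebesgue R) K (fun t => w t *: (F t *m x t))) 0 0
  <= \int[@elebesgue R]_(t in K) (w t * ((x t)^T *m U *m x t) 0 0).
Proof.
move=> x xL2; cbv zeta.
pose B := wgram (@elebesgue R) K w x f.
have colE :
    mxRintegral (@elebesgue R) K (fun t => w t *: (kron_id n (f t) *m x t)) =
    mxcolvec B.
  apply/colP => k; rewrite !mxE; apply: eq_Rintegral => t _.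
  by rewrite kron_id_mul_vec !mxE.
have rowE : mxRintegral (@elebesgue R) K
    (fun t => w t *: ((x t)^T *m (kron_id n (f t))^T)) = (mxcolvec B)^T.
  rewrite -colE -mxRintegral_tr; congr mxRintegral; apply/funext => t.
  by rewrite linearZ/= trmx_mul.
rewrite colE rowE vec_tensmx_quad; apply: gram_trace_le => // v.
exact: posdefmx_ge0.
Qed.
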